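(* Fix $\theta>0$ and an integer $j_0$. For each $j\ge j_0$ let $U_j$ be a real Hilbert space, $u_j:[0,\infty)\to U_j$ a measurable input, $\mathsf Z_j$ a causal bridge with output $y_j=\mathsf Z_j[u_j]$, and let times $t_{j_0}<\infty$ and $t_{j+1}:=\inf\{t\ge t_j: E_{j+1}(t)\ge\theta\}$ be defined recursively, where $E_{j+1}(t)=0$ for $t<t_j$ and $E_{j+1}(t)=\sup_{s\in[t_j,t]}(S_j(x_j(s))-S_j(x_j(t_j)))$ for $t\ge t_j$. Set $\Delta t_j=t_{j+1}-t_j$. Assume that for all sufficiently large $j$: (a) there is a storage functional $S_j\ge0$ on an internal state $x_j(t)$ with $S_j(x_j(t))-S_j(x_j(s))\le\int_s^tp_j\le W_j^+[s,t]$ for all $s<t$; (b) $t\mapsto E_{j+1}(t)$ is right-continuous and $t_{j+1}<\infty$; (c) (ICAP) $W^+_{j,\mathrm{win}}[s,t]\le\Lambda(j)\int_s^t\|u_j(\tau)\|^2_{U_j}d\tau$ for the interval $[s,t]=[t_j,t_{j+1}]$, with $\Lambda(j)\in(0,\infty)$; (d) (FEAS) $\int_{t_j}^{t_{j+1}}\|u_j\|^2_{U_j}\le\bar B(j)\Delta t_j$ with $\bar B(j)\in(0,\infty)$; (e) (ALIGN) $W_j^+[t_j,t_{j+1}]\le W^+_{j,\mathrm{win}}[t_j,t_{j+1}]$. Let $\mathrm{Cap}(j):=\Lambda(j)\bar B(j)$. If $\sum_{j\ge j_0}1/\mathrm{Cap}(j)=\infty$, then $\sum_{j\ge j_0}\Delta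 t_j=\infty$ (no Zeno cascade: the $t_j$ are unbounded).
   Context: $p_j(t)=\langle u_j(t),y_j(t)\rangle_{U_j}$, $p_j^+=\max\{p_j,0\}$, $W_j^+[s,t]=\int_s^tp_j^+(\tau)d\tau$. For $s<t$, with truncated input $u_j^{[s,t]}=u_j\mathbf 1_{[s,t]}$ and output $y_j^{[s,t]}=\mathsf Z_j[u_j^{[s,t]}]$, the windowed positive work is $W^+_{j,\mathrm{win}}[s,t]=\int_s^t\max\{\langle u_j(\tau),y_j^{[s,t]}(\tau)\rangle,0\}d\tau$. A causal bridge is a map on input signals whose output on $[0,t]$ depends only on the input on $[0,t]$. *)

(* Defs.v *)
From HB Require Import structures.
From mathcomp Require Export all_boot all_order all_algebra.
From mathcomp Require Export sesquilinear.
From mathcomp Require Export all_classical all_reals all_analysis.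

Set Implicit Arguments.
Unset Strict Implicit.
Unset Printing Implicit Defensive.

Export Order.TTheory GRing.Theory Num.Theory.
Export numFieldNormedType.Exports.

#[export] Set Implicit Arguments.
#[export] Unset Strict Implicit.
#[export] Unset Printing Implicit Defensive.

Local Open Scope classical_set_scope.
Local Open Scope ring_scope.

Record hilbertSpace (R : realType) := HilbertSpace {
  hilbert_sort :> completeNormedModType R ;
  inner : {dot hilbert_sort for idfun} ;
  normsq_inner : forall v : hilbert_sort, `|v| ^+ 2 = inner v v
}.

(* A signal [0, +oo[ -> U is represented by a total function R -> U of which
   only the values at nonnegative times are meaningful. *)
Section signals.
Context {R : realType} {U : hilbertSpace R}.
Implicit Types (u v y : R -> U) (Z : (R -> U) -> (R -> U)) (s t : R).

Local Notation mu := (@lebesgue_measure R).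

(* U carries its Borel sigma-algebra. *)
Definition measurable_signal u : Prop :=
  measurable_fun (`[0, +oo[%classic : set R)
    (u : R -> g_sigma_algebraType (@open U)).

Definition causal_bridge Z : Prop :=
  forall u v, measurable_signal u -> measurable_signal v ->
  forall t, 0 <= t -> {in `[0, t], u =1 v} -> {in `[0, t], Z u =1 Z v}.

Definition power u y (tau : R) : R := inner U (u tau) (y tau).

Definition work u y s t : \bar R :=
  (\int[mu]_(tau in `[s, t]) (power u y tau)%:E)%E.

Definition pos_work u y s t : \bar R :=
  (\int[mu]_(tau in `[s, t]) (Num.max (power u y tau) 0)%:E)%E.

Definition truncate u s t : R -> U := fun tau => \1_`[s, t] tau *: u tau.

Definition win_pos_work Z u s t : \bar R :=
  (\int[mu]_(tau in `[s, t])
     (Num.max (inner U (u tau) (Z (truncate u s t) tau)) 0)%:E)%E.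

Definition input_energy u s t : \bar R :=
  (\int[mu]_(tau in `[s, t]) (`|u tau| ^+ 2)%:E)%E.

End signals.

(* With a = t_j and g = S_j \o x_j this is E_{j+1}.  The start time a may be
   +oo, when an earlier threshold is never reached; then it is constantly 0. *)
Definition excess {R : realType} (a : \bar R) (g : R -> R) (t : R) : \bar R :=
  if (t%:E < a)%E then 0%E
  else ereal_sup [set (g s - g (fine a))%:E | s in [set s | (a <= s%:E)%E /\ s <= t]].

(* The infimum of the empty set is +oo. *)
Definition next_time {R : realType} (theta : R) (a : \bar R) (g : R -> R) : \bar R :=
  ereal_inf [set t%:E | t in [set t : R | (a <= t%:E)%E /\
                                          (theta%:E <= excess a g t)%E]].

(* Main.v *)
Require Import Defs.
From mathcomp Require Import zify.

(* Right continuity of the running supremum E_{j+1} makes the infimum defining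
   t_{j+1} attained, so theta <= E_{j+1}(t_{j+1}) <= W_j^+[t_j, t_{j+1}] by the
   storage inequality.  ALIGN, ICAP and FEAS bound the right-hand side by
   Cap(j) * Dt_j, hence Dt_j >= theta / Cap(j) for all large j, and divergence
   of the sum of 1 / Cap(j) transfers to the sum of the Dt_j. *)

Local Open Scope classical_set_scope.
Local Open Scope ring_scope.

(* No measurability is needed: for a nonnegative integrand the integral is a
   supremum over the simple functions lying below it. *)
Lemma ge0_integral_subset (d : measure_display) (T : measurableType d)
    (R : realType) (mu : {measure set T -> \bar R}) (A D : set T)
    (f : T -> \bar R) :
  (forall x, D x -> (0 <= f x)%E) -> A `<=` D ->
  (\int[mu]_(x in A) f x <= \int[mu]_(x in D) f x)%E.
Proof.
move=> f0 AD; rewrite !ge0_integralE//; last by move=> x /AD/f0.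
apply: ereal_sup_le => _ [h hf <-]; exists h => //= x.
exact: le_trans (hf x) (restrict_lee f0 AD x).
Qed.

Lemma pos_work_ge0 (R : realType) (U : hilbertSpace R) (u y : R -> U) (s t : R) :
  (0 <= pos_work u y s t)%E.
Proof. by apply: integral_ge0 => r _; rewrite lee_fin le_max lexx orbT. Qed.

Lemma pos_work_le (R : realType) (U : hilbertSpace R) (u y : R -> U) (s r t : R) :
  r <= t -> (pos_work u y s r <= pos_work u y s t)%E.
Proof.
move=> rt; apply: ge0_integral_subset => [z _|].
  by rewrite lee_fin le_max lexx orbT.
by move=> z /=; rewrite !in_itv/= => /andP[-> /le_trans]; apply.
Qed.

Lemma excess_le (R : realType) (a : R) (g : R -> R) (r t : R) :
  r <= t -> (excess a%:E g r <= excess a%:E g t)%E.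
Proof.
move=> rt; rewrite /excess !lte_fin; case: (ltP r a) => ra; case: (ltP t a) => ta //.
(* Here [r < a <= t]: the left side is the default 0, which the supremum on the right attains as the
   increment at [s = a]. *)
- apply: ereal_sup_ubound; exists a; last by rewrite subrr.
  by split; rewrite ?lee_fin.
- by have := lt_le_trans ta (le_trans ra rt); rewrite ltxx.
- by apply: ereal_sup_le => _ [s [als sr] <-]; exists s => //; split => //; exact: le_trans rt.
Qed.

(** Any [r > b] lies strictly above the infimum, so some [s < r] has already reached the threshold,
    and monotonicity carries [theta] to the excess at [r]. Letting [r] decrease to [b], right
    continuity gives the bound at [b] itself. *)
Lemma excess_next_time (R : realType) (theta a b : R) (g : R -> R) :
  right_continuous (excess a%:E g) -> next_time theta a%:E g = b%:E ->
  (theta%:E <= excess a%:E g b)%E.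
Proof.
move=> rc nb.
have <- : lim (excess a%:E g r @[r --> b^'+]) = excess a%:E g b.
  by apply: cvg_lim (rc b); exact: ereal_hausdorff.
apply: lime_ge; first by apply/cvg_ex; exists (excess a%:E g b); exact: rc.
near=> r.
have : (next_time theta a%:E g < r%:E)%E by rewrite nb lte_fin.
move=> /ereal_inf_lt[_ [s [_ sE] <-]]; rewrite lte_fin => /ltW sr.
exact: le_trans sE (excess_le _ _ sr).
Unshelve. all: by end_near. Qed.

Lemma next_time_ge (R : realType) (theta : R) (a : \bar R) (g : R -> R) :
  (a <= next_time theta a g)%E.
Proof. by apply: le_ereal_inf_tmp => _ [s [a_le_s _] <-]. Qed.

Lemma next_time_pos_work (R : realType) (U : hilbertSpace R) (u y : R -> U)
    (theta a b : R) (g : R -> R) :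
  a <= b -> right_continuous (excess a%:E g) -> next_time theta a%:E g = b%:E ->
  (forall r, a < r -> ((g r - g a)%:E <= pos_work u y a r)%E) ->
  (theta%:E <= pos_work u y a b)%E.
Proof.
move=> ab rc nb gW; apply: le_trans (excess_next_time rc nb) _.
rewrite /excess lte_fin ltNge ab /=; apply: ge_ereal_sup => _ [s [as_ sb] <-].
(* The bound on increments is available only for [a < s]; at [s = a] the increment is 0. *)
have [->|sa] := eqVneq s a; first by rewrite subrr pos_work_ge0.
have a_lt_s : a < s by rewrite lt_neqAle eq_sym sa -lee_fin.
exact: le_trans (gW _ a_lt_s) (pos_work_le _ _ _ sb).
Qed.

(** If the sums from [N] on stayed below [M], the series would be at most its finite head plus [M].
    The sign of the terms is known only from [N] on, just as [Cap] is known to be positive only for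
    large [j]. *)
Lemma eseries_pinfty_unbounded (R : realType) (c : nat -> R) (N : nat) (M : R) :
  (forall k, (N <= k)%N -> 0 <= c k) ->
  (\sum_(0 <= k <oo) (c k)%:E = +oo)%E ->
  exists2 n, (N <= n)%N & M < \sum_(N <= k < n) c k.
Proof.
move=> c0 cdiv; apply: contrapT => bounded.
have cM n : (N <= n)%N -> \sum_(N <= k < n) c k <= M.
  by move=> Nn; rewrite leNgt; apply/negP => Mn; apply: bounded; exists n.
pose s n := (\sum_(0 <= k < n) (c k)%:E)%E.
have sE n : (N <= n)%N ->
    s n = (\sum_(0 <= k < N) c k + \sum_(N <= k < n) c k)%:E.
  by move=> Nn; rewrite /s sumEFin (@big_cat_nat _ _ _ N).
(* The head may oscillate, so monotone convergence is applied to the sequence shifted by [N]. *)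
have scvg : cvgn s.
  apply/cvg_ex; exists (limn (fun n => s (n + N)%N)).
  rewrite -(cvg_shiftn N); apply: ereal_nondecreasing_is_cvgn => m n mn.
  rewrite /= !sE ?leq_addl// lee_fin lerD2l.
  rewrite (@big_cat_nat _ _ _ (m + N) N (n + N))/= ?leq_addl ?leq_add2r//.
  rewrite lerDl big_nat_cond sumr_ge0// => k /andP[/andP[mk _] _].
  by rewrite c0// (leq_trans _ mk)// leq_addl.
suff : (limn s <= (\sum_(0 <= k < N) c k + M)%:E)%E.
  by rewrite /s cdiv leye_eq.
apply: lime_le => //; near=> n.
have Nn : (N <= n)%N by near: n; exact: nbhs_infty_ge.
by rewrite sE// lee_fin lerD2l cM.
Unshelve. all: by end_near. Qed.

Theorem mainTheorem7 (R : realType) (theta : R) (j0 : int)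
    (U : int -> hilbertSpace R)
    (u : forall j : int, R -> U j)
    (Z : forall j : int, (R -> U j) -> (R -> U j))
    (X : int -> Type) (x : forall j : int, R -> X j) (S : forall j : int, X j -> R)
    (t : int -> \bar R) (Lambda B : int -> R)
    (y := fun j : int => Z j (u j))
    (g := fun j : int => fun s : R => S j (x j s))
    (Enext := fun j : int => excess (t j) (g j))
    (Dt := fun j : int => (t (j + 1)%R - t j)%E)
    (Cap := fun j : int => Lambda j * B j)
    (theta_gt0 : 0 < theta)
    (u_meas : forall j : int, j0 <= j -> measurable_signal (u j))
    (Z_causal : forall j : int, j0 <= j -> causal_bridge (Z j))
    (t_init : (0 <= t j0 < +oo)%E)
    (t_rec : forall j : int, j0 <= j -> t (j + 1) = next_time theta (t j) (g j))
    (hyps : exists J : int, forall j : int, j0 <= j -> J <= j ->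
      let a := fine (t j) in let b := fine (t (j + 1)) in
      [/\ (* (a) storage *)
          (forall z : X j, 0 <= S j z) /\
          (forall s r : R, 0 <= s -> s < r ->
             ((S j (x j r) - S j (x j s))%R%:E <= work (u j) (y j) s r)%E /\
             (work (u j) (y j) s r <= pos_work (u j) (y j) s r)%E),
          (* (b) *)
          right_continuous (Enext j) /\ (t (j + 1)%R < +oo)%E,
          (* (c) ICAP *)
          0 < Lambda j /\
          (win_pos_work (Z j) (u j) a b <= (Lambda j)%:E * input_energy (u j) a b)%E,
          (* (d) FEAS *)
          0 < B j /\ (input_energy (u j) a b <= (B j)%:E * Dt j)%E
        & (* (e) ALIGN *)
          (pos_work (u j) (y j) a b <= win_pos_work (Z j) (u j) a b)%E])
    (Cap_div : (\sum_(0 <= k <oo) ((Cap (j0 + k%:Z))^-1)%R%:E = +oo)%E) :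
  (\sum_(0 <= k <oo) Dt (j0 + k%:Z)%R = +oo)%E /\
  (forall M : R, exists2 j : int, j0 <= j & (M%:E < t j < +oo)%E).

Proof.
have [J hJ] := hyps.
have t_le j : j0 <= j -> (t j <= t (j + 1)%R)%E.
  by move=> j0j; rewrite t_rec//; exact: next_time_ge.
have tS k : (j0 + k%:Z + 1) = (j0 + k.+1%:Z) by rewrite -addrA -PoszD addn1.
have j0_le k : j0 <= j0 + k%:Z by rewrite lerDl.
have tN_le m n : (m <= n)%N -> (t (j0 + m%:Z)%R <= t (j0 + n%:Z)%R)%E.
  move=> /subnK <-; elim: (n - m)%N => [//|k ih]; apply: le_trans ih _.
  by rewrite addSn -tS t_le.
(* The absolute value also covers [J < j0], where every index is already late enough. *)
pose N := `|J - j0|%N.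
have J_le k : (N <= k)%N -> J <= j0 + k%:Z by rewrite /N; lia.
(* Hypothesis (b) makes all t_j finite, including the early ones. *)
have t_fin k : t (j0 + k%:Z) \is a fin_num.
  have t0 : (0 <= t (j0 + k%:Z)%R)%E.
    have /andP[t00 _] := t_init; apply: le_trans t00 _.
    by have := @tN_le 0 k isT; rewrite addr0.
  rewrite ge0_fin_numE//.
  have [_ [_ tfin] _ _ _] := hJ _ (j0_le (N + k)%N) (J_le _ (leq_addr _ _)).
  by apply: le_lt_trans tfin; rewrite tS tN_le// -addnS; lia.
pose T k := fine (t (j0 + k%:Z)).
have tE k : t (j0 + k%:Z) = (T k)%:E by rewrite /T fineK.
have T_le m n : (m <= n)%N -> T m <= T n by move=> mn; rewrite -lee_fin -!tE tN_le.
(* The storage inequality is assumed only from nonnegative times. *)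
have T_ge0 k : 0 <= T k.
  apply: le_trans (T_le 0%N k isT); have /andP[t00 _] := t_init.
  by rewrite -lee_fin -tE addr0.
have DtE k : Dt (j0 + k%:Z) = (T k.+1 - T k)%:E by rewrite /Dt tS !tE EFinB.
have step k : (N <= k)%N ->
    0 < Cap (j0 + k%:Z) /\ theta <= Cap (j0 + k%:Z) * (T k.+1 - T k).
  move=> Nk; have := hJ _ (j0_le k) (J_le _ Nk); rewrite /= DtE tS !tE /=.
  move=> [[_ storage] [rc _] [L0 icap] [B0 feas] align].
  split; first exact: mulr_gt0.
  rewrite -lee_fin; have gW r : T k < r ->
      ((g (j0 + k%:Z) r - g (j0 + k%:Z) (T k))%R%:E
        <= pos_work (u (j0 + k%:Z)%R) (y (j0 + k%:Z)%R) (T k) r)%E.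
    by move=> kr; have [h1 h2] := storage _ _ (T_ge0 k) kr; exact: le_trans h2.
  have nb : next_time theta (T k)%:E (g (j0 + k%:Z)) = (T k.+1)%:E.
    by rewrite -!tE -t_rec// tS.
  rewrite /Enext tE in rc.
  apply: le_trans (next_time_pos_work (T_le _ _ (leqnSn k)) rc nb gW) _.
  apply: le_trans align _; apply: le_trans icap _.
  (* What remains is FEAS multiplied by [Lambda j > 0]. *)
  by rewrite /Cap -mulrA EFinM lee_pmul2l ?lte_fin// EFinM.
have T_unbounded M : exists n, M < T n.
  have c0 k : (N <= k)%N -> 0 <= (Cap (j0 + k%:Z))^-1.
    by move=> /step[/ltW]; rewrite invr_ge0.
  (* The threshold is chosen so that [theta] times the partial sum exceeds [M - T N]; by [step] and
     telescoping, that product is at most [T n - T N]. *)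
  have [n Nn hn] := eseries_pinfty_unbounded ((M - T N) / theta) c0 Cap_div.
  exists n; move: hn; rewrite ltr_pdivrMr// => /lt_le_trans.
  suff h : (\sum_(N <= k < n) (Cap (j0 + k%:Z))^-1) * theta <= T n - T N.
    by move=> /(_ _ h); rewrite ltrD2r.
  rewrite -(telescope_sumr T Nn) mulr_suml big_nat_cond [leRHS]big_nat_cond.
  apply: ler_sum => k /andP[/andP[Nk _] _]; have [C0 hC] := step _ Nk.
  by rewrite ler_pdivrMl.
split; last first.
  move=> M; have [n Mn] := T_unbounded M; exists (j0 + n%:Z) => //.
  by rewrite tE ltry lte_fin Mn.
(* All increments are nonnegative, early ones included, so the series dominates its partial sum
   [T n - T 0], which exceeds [r] for a suitable [n]. *)
apply: eq_infty => r; have [n rn] := T_unbounded (r + T 0%N).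
apply: le_trans (@nneseries_lim_ge _ _ xpredT 0%N n _); last first.
  by move=> k _ _; rewrite DtE lee_fin subr_ge0 T_le.
under eq_bigr do rewrite DtE.
by rewrite sumEFin telescope_sumr// lee_fin lerBrDr ltW.
Qed.
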